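(* Let $n\ge 3$ and let $BS_n$ be the $n$-dimensional bubble-sort star graph. Then $\mathrm{smp}(BS_n)=2$, and every optimal strong matching preclusion set of $BS_n$ is a set of two vertices from the same bipartition set of $BS_n$.
   Context: For a permutation $v=v_1v_2\cdots v_n$ of $[1,n]=\{1,\dots,n\}$ and distinct $i,j\in[1,n]$, $v\circ\langle i,j\rangle$ denotes the permutation obtained from $v$ by exchanging the entries in positions $i$ and $j$. The $n$-dimensional bubble-sort star graph $BS_n$ ($n\ge 2$) has as vertex set all permutations of $[1,n]$, and two distinct vertices $u,v$ are adjacent iff $u=v\circ\langle 1,i\rangle$ for some $i\in[2,n]$, or $u=v\circ\langle i-1,i\rangle$ for some $i\in[3,n]$. It is a bipartite $(2n-3)$-regular graph on $n!$ vertices. A perfect matching covers every vertex; an almost-perfect matching covers all vertices but one. For $F^*\subseteq V(G)\cup E(G)$, $G-F^*$ is the graph obtained by deleting the vertices in $F^*$ (with their incident edges) and the edges in $F^*$. $F^*$ is a strong matching preclusion set of $G$ if $G-F^*$ has neither a perfect matching nor an almost-perfect matching; $\mathrm{smp}(G)$ is the minimum size of such a set, and a strong matching preclusion set of size $\mathrm{smp}(G)$ is called optimal. *)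

(* Defs.v *)
From HB Require Import structures.
From mathcomp Require Import all_boot.
From mathcomp Require Import fingroup perm.

Set Implicit Arguments.
Unset Strict Implicit.
Unset Printing Implicit Defensive.

Record sgraph := SGraph {
  vertex :> finType;
  adj : rel vertex;
  adj_sym : symmetric adj;
  adj_irr : irreflexive adj }.

Definition edges (G : sgraph) : {set {set G}} :=
  [set e | [exists x, exists y, adj x y && (e == [set x; y])]].

(* A set of vertices and edges of G is a set in the sum type: [inl x] is the
   vertex x and [inr e] the edge e; [inr e] is only admissible if e is
   really an edge of G. *)
Definition fault_set (G : sgraph) (F : {set G + {set G}}) : Prop :=
  forall e : {set G}, inr e \in F -> e \in edges G.

Definition remaining_vertices (G : sgraph) (F : {set G + {set G}}) : {set G} :=
  [set x | inl x \notin F].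

Definition remaining_edges (G : sgraph) (F : {set G + {set G}}) :
    {set {set G}} :=
  [set e in edges G | (inr e \notin F) && (e \subset remaining_vertices F)].

Definition matching (T : finType) (E M : {set {set T}}) : Prop :=
  M \subset E /\ trivIset M.

Definition has_perfect_matching (T : finType) (V : {set T})
    (E : {set {set T}}) : Prop :=
  exists2 M : {set {set T}}, matching E M & cover M = V.

Definition has_almost_perfect_matching (T : finType) (V : {set T})
    (E : {set {set T}}) : Prop :=
  exists2 M : {set {set T}}, matching E M &
    exists2 x : T, x \in V & cover M = V :\ x.

Definition strong_matching_preclusion_set (G : sgraph)
    (F : {set G + {set G}}) : Prop :=
  [/\ fault_set F,
      ~ has_perfect_matching (remaining_vertices F) (remaining_edges F) &
      ~ has_almost_perfect_matching (remaining_vertices F) (remaining_edges F)].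

(* [smp_is G k] reads smp(G) = k; it is a relation because some graphs
   (e.g. a single vertex) have no strong matching preclusion set at all. *)
Definition smp_is (G : sgraph) (k : nat) : Prop :=
  (exists2 F : {set G + {set G}},
     strong_matching_preclusion_set F & #|F| = k) /\
  (forall F : {set G + {set G}},
     strong_matching_preclusion_set F -> k <= #|F|).

Definition optimal_smp_set (G : sgraph) (F : {set G + {set G}}) : Prop :=
  strong_matching_preclusion_set F /\ smp_is G #|F|.

Definition bipartition (G : sgraph) (A B : {set G}) : Prop :=
  B = ~: A /\
  forall x y : G, adj x y ->
    (x \in A) && (y \in B) || (x \in B) && (y \in A).

(* Positions and entries are numbered from 0: the transpositions <1,i>,
   2 <= i <= n, become (0,j), 0 < j < n, and <i-1,i>, 3 <= i <= n, become
   (i,i+1), 0 < i < n-1. *)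
Definition bs_positions (n : nat) (i j : 'I_n) : bool :=
  ((i == 0 :> nat) && (0 < j)) || ((0 < i) && (j == i.+1 :> nat)).

(* v is the word v_0 ... v_(n-1) with v_k = v k.  As permutations compose from
   left to right, [swap_positions v i j] maps k to v (tperm i j k). *)
Definition swap_positions (n : nat) (v : 'S_n) (i j : 'I_n) : 'S_n :=
  (tperm i j * v)%g.

Definition bs_adj (n : nat) : rel 'S_n := fun u v =>
  [exists i, exists j, bs_positions i j && (u == swap_positions v i j)].

Lemma bs_adjP n (u v : 'S_n) :
  reflect (exists i j, bs_positions i j /\ u = swap_positions v i j)
          (bs_adj u v).
Proof.
apply: (iffP existsP) => [[i /existsP[j /andP[p /eqP e]]]|[i [j [p ->]]]].
  by exists i, j.
by exists i; apply/existsP; exists j; rewrite p eqxx.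
Qed.

Lemma bs_positions_neq n (i j : 'I_n) : bs_positions i j -> i != j.
Proof.
case/orP=> /andP[]; rewrite -val_eqE /=.
  by move=> /eqP->; rewrite eq_sym lt0n.
by move=> _ /eqP->; rewrite neq_ltn ltnSn.
Qed.

Lemma bs_adj_odd n (u v : 'S_n) : bs_adj u v -> odd_perm u = ~~ odd_perm v.
Proof.
by case/bs_adjP=> i [j [/bs_positions_neq p ->]]; rewrite odd_mul_tperm p.
Qed.

Lemma bs_adj_sym n : symmetric (@bs_adj n).
Proof.
suff sub (u v : 'S_n) : bs_adj u v -> bs_adj v u.
  by move=> u v; apply/idP/idP; apply: sub.
case/bs_adjP=> i [j [p ->]]; apply/bs_adjP; exists i, j; split=> //.
by rewrite /swap_positions mulgA tperm2 mul1g.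
Qed.

Lemma bs_adj_irr n : irreflexive (@bs_adj n).
Proof.
by move=> u; case uu: (bs_adj u u) => //; have := bs_adj_odd uu; case: odd_perm.
Qed.

Definition BS (n : nat) : sgraph := SGraph (@bs_adj_sym n) (@bs_adj_irr n).

Lemma bs_bipartition n :
  @bipartition (BS n) [set u : 'S_n | ~~ odd_perm u] [set u : 'S_n | odd_perm u].
Proof.
split=> [|x y xy]; first by apply/setP=> u; rewrite !inE negbK.
by rewrite !inE (bs_adj_odd xy); case: odd_perm.
Qed.

(* Main.v *)
(* Left multiplication by a generating transposition [t] is a fixed-point free
   matching of [BS n].  A fault set of size at most 2 containing at most one
   vertex misses all the edges of one of the three matchings given by <0,1>,
   <0,2>, <1,2>.  If the faults are two vertices of opposite parity, start from
   a matching [t] and exchange the edges along an alternating path joining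
   them; it exists because the products [s * t], [s] a generator, generate all
   even permutations.  Two vertices of the same parity unbalance the
   bipartition by 2. *)
Require Import Defs.
From mathcomp Require Import all_boot.
From mathcomp Require Import fingroup perm.

Set Implicit Arguments.
Unset Strict Implicit.
Unset Printing Implicit Defensive.

(** * Matchings of finite sets: construction and counting *)

(** Two edges [[set x; f x]] could only meet in a common point of [A], in a common value of [f], or
    in a value of [f] inside [A]; the last is excluded. In both uses [A] consists of even vertices
    and [f] reverses parity on it. *)
Lemma injection_matching (T : finType) (E : {set {set T}}) (A : {set T})
    (f : T -> T) :
    {in A &, injective f} -> {in A, forall x, f x \notin A} ->
    {in A, forall x, [set x; f x] \in E} ->
  exists2 M, matching E M & cover M = A :|: f @: A.
Proof.
move=> f_inj fA fE; exists [set [set x; f x] | x in A]; first split.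
- by apply/subsetP=> _ /imsetP[x xA ->]; apply: fE.
- apply/trivIsetP=> _ _ /imsetP[x xA ->] /imsetP[y yA ->] neq.
  have neq_xy : x != y by apply: contraNneq neq => ->.
  rewrite -setI_eq0; apply/eqP/setP=> z; rewrite !inE.
  apply/negP=> /andP[/orP[]/eqP-> /orP[]/eqP].
  + by move/eqP; rewrite (negPf neq_xy).
  + by move=> e; have := fA _ yA; rewrite -e xA.
  + by move=> e; have := fA _ xA; rewrite e yA.
  + by move/(f_inj _ _ xA yA)/eqP; rewrite (negPf neq_xy).
apply/setP=> z; apply/bigcupP/setUP=> [[_ /imsetP[x xA ->]]|].
  by rewrite !inE => /orP[]/eqP->; [left | right; apply: imset_f].
have edgeM x : x \in A -> [set x; f x] \in [set [set y; f y] | y in A].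
  by move=> xA; apply/imsetP; exists x.
case=> [zA|/imsetP[x xA ->]].
  by exists [set z; f z]; rewrite ?edgeM // !inE eqxx.
by exists [set x; f x]; rewrite ?edgeM // !inE eqxx orbT.
Qed.

(** With [A] a parity class, this makes every matching cover as many even as odd vertices. *)
Lemma card_cover_transversal (T : finType) (M : {set {set T}}) (A : {set T}) :
    trivIset M -> {in M, forall e, #|e :&: A| = 1} ->
  #|cover M :&: A| = #|M|.
Proof.
move=> tM MA.
have cardI (B : {set T}) : #|B :&: A| = \sum_(x in B | x \in A) 1.
  by rewrite -sum1_card; apply: eq_bigl => x; rewrite inE.
rewrite cardI big_trivIset_cond //=.
rewrite (eq_bigr (fun=> 1)) ?sum1_card // => e eM.
by rewrite -cardI; apply: MA.
Qed.

Lemma mem_edges (G : sgraph) (x y : G) : adj x y -> [set x; y] \in edges G.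
Proof.
by move=> xy; rewrite inE; apply/existsP; exists x; apply/existsP; exists y;
   rewrite xy eqxx.
Qed.

(** * [BS n] as a Cayley graph for left multiplication *)

Definition bs_gen n (t : 'S_n) : bool :=
  [exists i, exists j, bs_positions i j && (t == tperm i j)].

Lemma bs_genP n (t : 'S_n) :
  reflect (exists i j, bs_positions i j /\ t = tperm i j) (bs_gen t).
Proof.
apply: (iffP existsP) => [[i /existsP[j /andP[p /eqP e]]]|[i [j [p ->]]]].
  by exists i, j.
by exists i; apply/existsP; exists j; rewrite p eqxx.
Qed.

Lemma bs_gen_adj n (t x : 'S_n) : bs_gen t -> bs_adj (t * x)%g x.
Proof. by case/bs_genP=> i [j [p ->]]; apply/bs_adjP; exists i, j. Qed.

Lemma bs_gen_invol n (t : 'S_n) : bs_gen t -> (t * t = 1)%g.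
Proof. by case/bs_genP=> i [j [_ ->]]; rewrite tperm2. Qed.

Lemma bs_genK n (t : 'S_n) : bs_gen t -> involutive (mulg t).
Proof. by move=> /bs_gen_invol t2 x; rewrite mulgA t2 mul1g. Qed.

Lemma bs_gen_odd n (t x : 'S_n) :
  bs_gen t -> odd_perm (t * x) = ~~ odd_perm x.
Proof. by move/(bs_gen_adj x)/bs_adj_odd. Qed.

Lemma bs_gen_star n (j : 'I_n.+1) : j != ord0 -> bs_gen (tperm ord0 j).
Proof.
by move=> j0; apply/bs_genP; exists ord0, j; rewrite /bs_positions /= lt0n j0.
Qed.

(** * Alternating paths, and faults at two vertices of opposite parity *)

(** Two edges at once: the matching edge from [x] to [t * x], then any edge from there to [y].
    Parity is therefore preserved. *)
Definition alt_step n (t : 'S_n) : rel 'S_n := fun x y => bs_adj (t * x)%g y.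

(** The [g] that carry every [x] to a vertex reachable from it form a subgroup [H] containing all
    [s * t]. Every permutation lies in [H] or becomes a member after multiplication by [t], and
    parity decides which. *)
Lemma connect_alt_step n (t u v : 'S_n.+1) :
  bs_gen t -> odd_perm u = odd_perm v -> connect (alt_step t) u v.
Proof.
move=> gt uv.
pose C := [set g : 'S_n.+1 | [forall x, connect (alt_step t) x (g * x)%g]].
have CP g : reflect (forall x, connect (alt_step t) x (g * x)%g) (g \in C).
  by rewrite inE; apply: forallP.
(* In a finite group, closure under products suffices, so inverses come for free. *)
have gC : group_set C.
  apply/group_setP; split=> [|g h /CP Cg /CP Ch]; apply/CP => x.
    by rewrite mul1g.
  by rewrite -mulgA; apply: connect_trans (Ch x) (Cg _).
pose H := Group gC.
have step s : bs_gen s -> (s * t)%g \in H.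
  move=> gs; apply/CP => x; apply: connect1.
  by rewrite /alt_step bs_adj_sym -mulgA; apply: bs_gen_adj.
(* The invariant is stable under each single generator, whatever the parity. *)
pose P (x : 'S_n.+1) := (x \in H) || ((t * x)%g \in H).
have Pgen s x : bs_gen s -> P x -> P (s * x)%g.
  move=> gs /orP[] Hx; apply/orP; [right | left].
    suff -> : (t * (s * x) = (s * t)^-1 * x)%g by rewrite groupM // groupV step.
    have inv r : bs_gen r -> (r^-1 = r)%g.
      by case/bs_genP=> i [j [_ ->]]; rewrite tpermV.
    by rewrite invMg !inv // mulgA.
  suff -> : (s * x = (s * t) * (t * x))%g by rewrite groupM // step.
  by rewrite -mulgA (bs_genK gt).
have Ptperm i j x : i != j -> P x -> P (tperm i j * x)%g.
  move=> ij Px; have [i0|i0] := eqVneq i ord0.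
    by rewrite i0 in ij *; apply: Pgen => //; apply: bs_gen_star; rewrite eq_sym.
  have [->|j0] := eqVneq j ord0; first by rewrite tpermC Pgen ?bs_gen_star.
  (* Conjugating one star transposition by another gives every remaining transposition. *)
  have -> : tperm i j = (tperm ord0 i * tperm ord0 j * tperm ord0 i)%g.
    have := tpermJ ord0 j (tperm ord0 i).
    by rewrite tpermL tpermD // 1?eq_sym // conjgE tpermV => <-; rewrite mulgA.
  by rewrite -!mulgA !Pgen ?bs_gen_star.
have PT x : P x.
  have [ts -> /allP dts] := prod_tpermP x.
  elim: ts dts => [|[i j] ts IH] dts; first by rewrite big_nil /P group1.
  rewrite big_cons; apply: Ptperm; first exact: (dts (i, j) (mem_head _ _)).
  by apply: IH => y yts; apply: dts; rewrite inE yts orbT.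
have step_odd x y : connect (alt_step t) x y -> odd_perm x = odd_perm y.
  case/connectP=> p; elim: p x => [|z p IH] x /=; first by move=> _ ->.
  case/andP=> /bs_adj_odd; rewrite bs_gen_odd // => /negb_inj -> /IH.
  exact.
(* The second alternative would connect [u] to [t * v], which has the opposite parity. *)
have /orP[/CP/(_ u)|/CP/(_ u) c] := PT (v * u^-1)%g; first by rewrite mulgKV.
have := step_odd _ _ c.
by rewrite -mulgA mulgKV bs_gen_odd // uv; case: odd_perm.
Qed.

(** Along a simple path of alternating steps from [u] to [t * v], each edge from [x] to [t * x]
    gives way to the edge from [t * x] to the successor of [x]. This frees exactly [u] and [v]. *)
Lemma bs_two_vertex_matching n (u v : 'S_n.+2) :
    ~~ odd_perm u -> odd_perm v ->
  exists2 M, matching (edges (BS n.+2)) M & cover M = ~: [set u; v].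
Proof.
move=> u_even v_odd; pose t : 'S_n.+2 := tperm ord0 (inord 1).
have gt : bs_gen t by apply: bs_gen_star; rewrite -val_eqE /= inordK.
have tK := bs_genK gt.
have /connectP[q pq eq_last] : connect (alt_step t) u (t * v)%g.
  by apply: connect_alt_step => //; rewrite bs_gen_odd // v_odd (negPf u_even).
(* Without repeated vertices, [next] and [prev] are inverse to each other. *)
case/shortenP: pq eq_last => p up uniq_up _ eq_last.
(* [f] is the matching [t] switched along the path [c]; [prev] wraps around at
   [u] and is the identity off [c], so that [f u = v]. *)
pose c := u :: p; pose f x := (t * prev c x)%g.
have fK y : f (next c (t * y)%g) = y by rewrite /f prev_next.
have f_inj : injective f.
  have f_can : cancel f (fun y => next c (t * y)%g).
    by move=> x; rewrite /f tK next_prev.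
  exact: can_inj f_can.
(* Closing the path into a cycle adds a step into [u] that need not be alternating; there [e] only
   records that the predecessor is [t * v]. *)
pose e x y := if y == u then x == (t * v)%g else alt_step t x y.
have e_path w s : u \notin s -> path (alt_step t) w s -> path e w s.
  elim: s w => //= y s IH w; rewrite inE negb_or => /andP[uy us] /andP[wy ys].
  by rewrite IH // andbT /e eq_sym (negPf uy).
have e_cycle : path.cycle e c.
  rewrite /c /= rcons_path {2}/e eqxx -eq_last eqxx andbT e_path //.
  by case/andP: uniq_up.
have e_prev := prev_cycle e_cycle.
have fu : f u = v.
  by have := e_prev u (mem_head _ _); rewrite /e eqxx /f => /eqP->; rewrite tK.
have f_adj x : x != u -> bs_adj (f x) x.
  move=> xu; have [xc|xc] := boolP (x \in c).
    by have := e_prev x xc; rewrite /e (negPf xu).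
  by rewrite /f prev_nth (negPf xc); apply: bs_gen_adj.
have f_odd x : x != u -> odd_perm (f x) = ~~ odd_perm x.
  by move/f_adj/bs_adj_odd.
pose A := [set x : 'S_n.+2 | ~~ odd_perm x && (x != u)].
have [||x|M MM cM] := @injection_matching _ (edges (BS n.+2)) A f.
- exact: in2W.
- by move=> x; rewrite !inE => /andP[ex xu]; rewrite f_odd // ex.
- rewrite inE => /andP[_ /f_adj fx].
  by apply: mem_edges; rewrite /= bs_adj_sym.
exists M => //; rewrite {}cM; apply/setP=> y; rewrite !inE negb_or.
apply/orP/andP=> [[/andP[ey yu]|/imsetP[x]]|[yu yv]].
- by rewrite yu; split=> //; apply: contraNneq ey => ->.
- rewrite inE => /andP[ex xu] ->; split.
    by apply: contraNneq u_even => <-; rewrite f_odd.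
  by rewrite -fu (inj_eq f_inj).
- have [y_odd|ey] := boolP (odd_perm y); last by left; rewrite yu.
  (* The preimage of [y] under [f] is not [u], because [f u = v] and [y] differs from [v]. *)
  right; apply/imsetP; exists (next c (t * y)%g); rewrite ?fK //.
  have xu : next c (t * y)%g != u.
    by apply: contraNneq yv => xu; rewrite -fu -xu fK.
  by rewrite inE xu andbT; have := f_odd _ xu; rewrite fK y_odd => /esym.
Qed.

(** * Fault sets of size at most two *)

(** Generators are involutions, so an edge yields the same generator from either end. Distinct
    generators thus have disjoint edge classes. *)
Lemma bs_gen_edge_inj n (s t x y : 'S_n) : bs_gen s -> bs_gen t ->
  [set x; s * x]%g = [set y; t * y]%g -> s = t.
Proof.
move=> gs gt e.
have tsx z : (t * z = s * z)%g -> s = t by move/mulIg.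
have neq (r z : 'S_n) : bs_gen r -> (r * z)%g <> z.
  by move=> gr /(congr1 (@odd_perm _)); rewrite bs_gen_odd //; case: odd_perm.
have : y \in [set x; s * x]%g by rewrite e !inE eqxx.
have : (t * y)%g \in [set x; s * x]%g by rewrite e !inE eqxx orbT.
rewrite !inE => /orP[]/eqP ty /orP[]/eqP yE.
- by case: (neq t y gt); rewrite ty.
- by apply: (tsx y); rewrite ty yE (bs_genK gs).
- by apply: (tsx y); rewrite ty yE.
- by case: (neq t y gt); rewrite ty.
Qed.

Lemma bs_gen_avoiding_edges n (F : {set BS n.+3 + {set BS n.+3}}) :
    #|F| <= 2 ->
  exists2 t : 'S_n.+3, bs_gen t &
    forall x : 'S_n.+3, inr [set x; t * x]%g \notin F.
Proof.
move=> F2.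
pose ok (t : 'S_n.+3) :=
  bs_gen t && [forall x : 'S_n.+3, inr [set x; t * x]%g \notin F].
have [/existsP[t /andP[gt /forallP tF]]|/existsPn none] := boolP [exists t, ok t].
  by exists t.
have bad t : bs_gen t -> exists x : 'S_n.+3, inr [set x; t * x]%g \in F.
  move=> gt; have := none t; rewrite /ok gt => /forallPn[x xF].
  by exists x; rewrite negbK in xF.
pose p k : 'I_n.+3 := inord k.
pose t01 := tperm ord0 (p 1); pose t02 := tperm ord0 (p 2).
pose t12 := tperm (p 1) (p 2).
have g01 : bs_gen t01 by apply: bs_gen_star; rewrite -val_eqE /= inordK.
have g02 : bs_gen t02 by apply: bs_gen_star; rewrite -val_eqE /= inordK.
have g12 : bs_gen t12.
  by apply/bs_genP; exists (p 1), (p 2); rewrite /bs_positions /= !inordK.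
have pneq i j : i < 3 -> j < 3 -> i != j -> p i != p j.
  by move=> i3 j3; rewrite -val_eqE /= !inordK // (leq_trans _ (isT : 3 <= n.+3)).
have p0 : ord0 = p 0 by apply: val_inj; rewrite /= inordK.
have n1 : t01 <> t02.
  move/permP/(_ ord0); rewrite !tpermL => /eqP; exact/negP/pneq.
have n2 : t01 <> t12.
  by move/permP/(_ ord0); rewrite tpermL tpermD p0 => [/eqP||];
    first apply/negP; apply: pneq.
have n3 : t02 <> t12.
  by move/permP/(_ ord0); rewrite tpermL tpermD p0 => [/eqP||];
    first apply/negP; apply: pneq.
(* A faulty edge in each of three disjoint classes would give three faults. *)
have [x xF] := bad _ g01; have [y yF] := bad _ g02; have [z zF] := bad _ g12.
suff : 2 < #|F| by rewrite ltnNge F2.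
apply/card_geqP.
exists [:: inr [set x; t01 * x]; inr [set y; t02 * y]; inr [set z; t12 * z]]%g.
split=> //=; last by move=> w; rewrite !inE => /or3P[]/eqP->.
have inr_neq s t (v w : 'S_n.+3) : bs_gen s -> bs_gen t -> s <> t ->
    (inr [set v; s * v]%g : BS n.+3 + {set BS n.+3}) != inr [set w; t * w]%g.
  by move=> gs gt st; apply/eqP=> -[/(bs_gen_edge_inj gs gt)].
by rewrite !inE negb_or !inr_neq.
Qed.

Lemma one_vertex_fault_not_smp n (F : {set BS n.+3 + {set BS n.+3}}) :
    #|F| <= 2 -> #|[set x : BS n.+3 | inl x \in F]| <= 1 ->
  ~ strong_matching_preclusion_set F.
Proof.
move=> F2; set W := [set x | _] => W1 [_ no_perfect no_almost].
have [t gt tF] := bs_gen_avoiding_edges F2.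
have tK := bs_genK gt.
(* Each surviving [t]-edge is represented by its even end. *)
pose A := [set x : BS n.+3 | [&& ~~ odd_perm x, x \notin W & (t * x)%g \notin W]].
have [||x|M MM cM] := @injection_matching _ (remaining_edges F) A (mulg t).
- by apply: in2W; apply: mulgI.
- by move=> x; rewrite !inE bs_gen_odd // => /andP[->].
- rewrite inE => /and3P[_ xW txW].
  rewrite inE tF mem_edges /=; last by rewrite bs_adj_sym bs_gen_adj.
  by rewrite subUset !sub1set; move: xW txW; rewrite !inE => -> ->.
have {}cM : cover M = [set x : BS n.+3 | (x \notin W) && ((t * x)%g \notin W)].
  rewrite cM; apply/setP=> x; rewrite in_setU (can_imset_pre A tK) !in_set.
  rewrite tK bs_gen_odd //.
  by case: (odd_perm x); case: (inl x \in F); case: (inl (t * x)%g \in F).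
have [W0|[w ww]] := set_0Vmem W.
  apply: no_perfect; exists M => //; rewrite cM; apply/setP=> x.
  have xW y : inl y \notin F by have := in_set0 y; rewrite -W0 inE => ->.
  by rewrite !inE !xW.
have WE : W = [set w].
  by apply/esym/eqP; rewrite eqEcard sub1set ww cards1.
(* The only vertex left uncovered is the [t]-partner of the faulty vertex. *)
apply: no_almost; exists M => //; exists (t * w)%g.
  rewrite inE; suff : (t * w)%g \notin W by rewrite inE.
  rewrite WE inE; apply/eqP=> /(congr1 (@odd_perm _)).
  by rewrite bs_gen_odd //; case: odd_perm.
apply/setP=> x; rewrite cM !inE andbC; congr (_ && _).
suff -> : (inl (t * x)%g \in F) = ((t * x)%g \in W).
  by rewrite WE inE (can2_eq tK tK).
by rewrite inE.
Qed.

(** The bound [#|F| <= 2], rather than equality, lets this serve both for the lower bound on smp and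
    for the description of optimal sets. *)
Lemma small_smp_set n (F : {set BS n.+3 + {set BS n.+3}}) :
    strong_matching_preclusion_set F -> #|F| <= 2 ->
  exists u v : 'S_n.+3,
    [/\ u <> v, F = [set inl u; inl v] & odd_perm u = odd_perm v].
Proof.
move=> FP F2.
have [W1|] := leqP #|[set x : BS n.+3 | inl x \in F]| 1.
  by case: (one_vertex_fault_not_smp F2 W1).
case/card_gt1P=> u [v []]; rewrite !inE => uF vF uv.
have FE : F = [set inl u; inl v].
  apply/esym/eqP; rewrite eqEcard subUset !sub1set uF vF /=.
  rewrite cards2; suff -> : (inl u : BS n.+3 + {set BS n.+3}) != inl v by [].
  by apply: contraNneq uv => -[->].
exists u, v; split=> //; first exact/eqP.
have [//|odd_uv] := eqVneq (odd_perm u) (odd_perm v).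
have V : remaining_vertices F = ~: [set u; v].
  by apply/setP=> x; rewrite FE !inE.
have [M [ME tM] cM] : exists2 M, matching (edges (BS n.+3)) M
    & cover M = ~: [set u; v].
  have [u_odd|u_even] := boolP (odd_perm u); last first.
    apply: bs_two_vertex_matching => //.
    by move: odd_uv u_even; do 2!case: odd_perm.
  rewrite setUC; apply: bs_two_vertex_matching => //.
  by move: odd_uv u_odd; do 2!case: odd_perm.
case: FP => _ no_perfect _; case: no_perfect.
exists M; last by rewrite V.
(* Edges of [M] lie inside its cover, so they avoid [u] and [v], and [F] contains no edges. *)
split=> //; apply/subsetP=> e eM; rewrite inE (subsetP ME) //= V -cM.
by rewrite (bigcup_sup e) // FE !inE.
Qed.

(** * Parity classes: unbalanced deletions and uniqueness of the bipartition *)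

Lemma bs_edge_card_parity n b (e : {set BS n}) :
  e \in edges (BS n) -> #|e :&: [set x : 'S_n | odd_perm x == b]| = 1.
Proof.
rewrite inE => /existsP[x /existsP[y /andP[/bs_adj_odd xy /eqP->]]].
have [xb|xb] := eqVneq (odd_perm x) b; apply/eqP/cards1P.
  exists x; apply/setP=> z; rewrite !inE.
  have [->|zx] /= := eqVneq z x; first by rewrite xb eqxx.
  have [->|//] /= := eqVneq z y; rewrite -xb xy; by case: odd_perm.
exists y; apply/setP=> z; rewrite !inE.
have [->|zy] /= := eqVneq z y.
  by rewrite orbT; move: xb; rewrite xy; case: odd_perm; case: b.
by rewrite orbF; have [->|//] /= := eqVneq z x; apply/negbTE.
Qed.

(** The two parity classes have equal size, and deleting [u] and [v] takes two vertices from one of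
    them. A matching covers both classes equally, and leaving out one more vertex cannot make up a
    difference of two. *)
Lemma two_vertices_smp n (u v : 'S_n.+2) :
    u <> v -> odd_perm u = odd_perm v ->
  strong_matching_preclusion_set
    ([set inl u; inl v] : {set BS n.+2 + {set BS n.+2}}).
Proof.
move=> uv odd_uv; set F : {set BS n.+2 + {set BS n.+2}} := [set _; _].
pose P b := [set x : BS n.+2 | odd_perm x == b].
have balanced M : matching (remaining_edges F) M ->
    #|cover M :&: P (odd_perm u)| = #|cover M :&: P (~~ odd_perm u)|.
  case=> /subsetP ME tM; rewrite !card_cover_transversal // => e /ME.
    by rewrite inE => /andP[ee _]; apply: bs_edge_card_parity.
  by rewrite inE => /andP[ee _]; apply: bs_edge_card_parity.
have cardP : #|P (odd_perm u)| = #|P (~~ odd_perm u)|.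
  pose t : 'S_n.+2 := tperm ord0 (inord 1).
  have gt : bs_gen t by apply: bs_gen_star; rewrite -val_eqE /= inordK.
  rewrite -(card_imset _ (mulgI t)); apply: eq_card => x.
  rewrite (can_imset_pre _ (bs_genK gt)) !inE bs_gen_odd //.
  by do 2!case: odd_perm.
have V : remaining_vertices F = ~: [set u; v].
  by apply/setP=> x; rewrite !inE.
(* Both kinds of matching are handled together: [x] is the vertex that may be left out, and in the
   perfect case it is taken to be the deleted vertex [u]. *)
have unbalanced (C : {set BS n.+2}) x : C \subset ~: [set u; v] ->
    ~: [set u; v] :\ x \subset C ->
  #|C :&: P (odd_perm u)| < #|C :&: P (~~ odd_perm u)|.
  move=> Cuv Cx.
  have le1 : #|C :&: P (odd_perm u)| + 2 <= #|P (odd_perm u)|.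
    have -> : 2 = #|[set u; v]| by rewrite cards2; move/eqP: uv => ->.
    rewrite -cardsUI.
    have -> : C :&: P (odd_perm u) :&: [set u; v] = set0.
      apply/setP=> y; rewrite !inE; apply/negP=> /andP[/andP[/(subsetP Cuv)]].
      by rewrite !inE => /negPf->.
    rewrite cards0 addn0 subset_leq_card // subUset subsetIr /=.
    by rewrite subUset !sub1set !inE odd_uv eqxx.
  have le2 : #|P (~~ odd_perm u)| <= #|C :&: P (~~ odd_perm u)| + 1.
    rewrite -(cards1 x) -cardsUI.
    apply: leq_trans (leq_addr _ _); apply/subset_leq_card/subsetP=> y yP.
    rewrite !inE orbC; have [//|yx] /= := eqVneq y x.
    move: (yP); rewrite inE => yP'; rewrite yP' andbT.
    apply: (subsetP Cx); rewrite !inE yx /=.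
    apply/norP; split; apply: contraTneq yP' => ->; rewrite -?odd_uv;
      by case: odd_perm.
  by rewrite -cardP in le2; move: (leq_trans le1 le2); rewrite addn2 addn1 ltnS.
split=> [e|[M MM cM]|[M MM [x xV cM]]]; first by rewrite !inE.
  have := unbalanced (cover M) u; rewrite cM V subxx subsetDl.
  by rewrite -V -cM (balanced M) // ltnn => /(_ isT isT).
have := unbalanced (cover M) x; rewrite cM V subxx subsetDl.
by rewrite -V -cM (balanced M) // ltnn => /(_ isT isT).
Qed.

(** An alternating step crosses two edges and changes side twice, so any bipartition is constant on
    vertices of equal parity. *)
Lemma bs_bipartition_parity n (A B : {set BS n.+2}) (u v : 'S_n.+2) :
    bipartition A B -> odd_perm u = odd_perm v ->
  [set u; v] \subset A \/ [set u; v] \subset B.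
Proof.
case=> -> adjA uv.
have flip (x y : 'S_n.+2) : bs_adj x y -> (x \in A) = (y \notin A).
  move=> xy; have := adjA x y xy; rewrite !inE.
  by case: (x \in A); case: (y \in A).
pose t : 'S_n.+2 := tperm ord0 (inord 1).
have gt : bs_gen t by apply: bs_gen_star; rewrite -val_eqE /= inordK.
suff e : (u \in A) = (v \in A).
  have [vA|vA] := boolP (v \in A); [left | right];
  by rewrite subUset !sub1set ?inE e ?vA.
have /connectP[p] := connect_alt_step gt uv.
elim: p u {uv} => [|y p IH] u /=; first by move=> _ ->.
case/andP=> /flip ty yp /(IH y yp) <-; apply: negb_inj.
by rewrite -ty (flip _ _ (bs_gen_adj u gt)).
Qed.

(** * The value of smp and the optimal sets *)

Theorem theorem2p7 (n : nat) (hn : 3 <= n) :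
  smp_is (BS n) 2 /\
  forall A B : {set BS n}, bipartition A B ->
  forall F : {set BS n + {set BS n}}, optimal_smp_set F ->
  exists u v : BS n,
    [/\ u <> v, F = [set inl u; inl v] &
        [set u; v] \subset A \/ [set u; v] \subset B].
Proof.
case: n hn => [|[|[|n]]] // _.
have card2 (u v : BS n.+3) : u <> v ->
    #|([set inl u; inl v] : {set BS n.+3 + {set BS n.+3}})| = 2.
  move=> uv; rewrite cards2.
  suff -> : (inl u : BS n.+3 + {set BS n.+3}) != inl v by [].
  by apply/eqP=> -[/uv].
have [u [v [uv odd_uv]]] :
    exists u v : 'S_n.+3, u <> v /\ odd_perm u = odd_perm v.
  (* A product of two transpositions sharing one point is a 3-cycle: even and not the identity. *)
  pose c : 'S_n.+3 := (tperm ord0 (inord 1) * tperm ord0 (inord 2))%g.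
  exists 1%g, c; split.
    move/permP/(_ ord0); rewrite perm1 permM tpermL tpermD => [/eqP||];
      by rewrite -val_eqE /= !inordK.
  by rewrite odd_perm1 odd_permM !odd_tperm -!val_eqE /= !inordK.
have smpF := two_vertices_smp uv odd_uv.
split.
  split; first by exists [set inl u; inl v]; rewrite ?card2.
  move=> F FP; have [//|lt2] := leqP 2 #|F|.
  have [x [y [xy FE _]]] := small_smp_set FP (ltnW lt2).
  by move: lt2; rewrite FE card2.
(* Minimality of [F], tested against the known set of two vertices, gives [#|F| <= 2]. *)
move=> A B AB F [FP [_ /(_ _ smpF)]]; rewrite card2 // => F2.
have [x [y [xy FE odd_xy]]] := small_smp_set FP F2.
by exists x, y; split=> //; apply: bs_bipartition_parity.
Qed.
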